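(* Let $X$ be a real Banach space. The following properties are equivalent. (a) $X$ is nonreflexive. (b) There is a continuous convex function $f\colon X\to(0,\infty)$ such that $1/f$ is not representable as a difference of two continuous convex functions on $X$. (c) There is a decreasing sequence $\{C_n\}_{n=1}^\infty$ of bounded closed convex subsets of $X$ such that $$\bigcap_{n=1}^{\infty} C_n=\emptyset \quad\text{and}\quad \bigcap_{n=1}^{\infty} (C_n + \varepsilon B_X) \neq \emptyset \text{ for every } \varepsilon>0,$$ where $B_X$ denotes the closed unit ball of $X$.
   Context: All functions are real-valued. A function on a Banach space is called d.c. if it is a difference of two continuous convex functions. *)

(* Defs.v *)
From HB Require Import structures.
From mathcomp Require Import all_boot all_order all_algebra.
From mathcomp Require Import all_classical all_reals all_analysis.
Set Implicit Arguments. Unset Strict Implicit. Unset Printing Implicit Defensive.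
Import Order.TTheory GRing.Theory Num.Theory.
Import numFieldNormedType.Exports.
Local Open Scope classical_set_scope.
Local Open Scope ring_scope.

Section Defs.
Context {R : realType} {X : normedModType R}.

Definition is_linear_functional (f : X -> R) : Prop :=
  forall (a : R) (x y : X), f (a *: x + y) = a * f x + f y.

Definition in_dual (f : X -> R) : Prop :=
  is_linear_functional f /\ continuous f.

Definition dual_norm_le (f : X -> R) (c : R) : Prop :=
  0 <= c /\ forall x : X, `|f x| <= c * `|x|.

Definition in_bidual (Phi : (X -> R) -> R) : Prop :=
  (forall (a : R) (f g : X -> R), in_dual f -> in_dual g ->
     Phi (fun x => a * f x + g x) = a * Phi f + Phi g) /\
  (exists M : R, forall (f : X -> R) (c : R), in_dual f -> dual_norm_le f c ->
     `|Phi f| <= M * c).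

Definition reflexive_space : Prop :=
  forall Phi : (X -> R) -> R, in_bidual Phi ->
    exists x : X, forall f : X -> R, in_dual f -> Phi f = f x.

Definition cont_convex (f : X -> R) : Prop :=
  continuous f /\ convex_function (R := R) (E := X) setT f.

Definition is_dc (h : X -> R) : Prop :=
  exists g1 g2 : X -> R, cont_convex g1 /\ cont_convex g2 /\
    forall x, h x = g1 x - g2 x.

Definition bounded_subset (C : set X) : Prop :=
  exists M : R, forall x, C x -> `|x| <= M.

Definition enlarge (C : set X) (eps : R) : set X :=
  [set y | exists2 x, C x & `|y - x| <= eps].

End Defs.

(* Main.v *)
Require Import Defs.
From HB Require Import structures.
From mathcomp Require Import all_boot all_order all_algebra.
From mathcomp Require Import all_classical all_reals all_analysis.
From mathcomp Require Import ring lra.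
Import Order.TTheory GRing.Theory Num.Theory.
Import numFieldNormedType.Exports.
Set Implicit Arguments. Unset Strict Implicit. Unset Printing Implicit Defensive.
Local Open Scope classical_set_scope.
Local Open Scope ring_scope.

(* (a) => (c): in a nonreflexive space James' construction gives d > 0,
   functionals phi_i of norm at most 1 and a bounded sequence x_n with
   phi_i x_n = d for i <= n and phi_i x_n = 0 for i > n.  Bounded closed convex
   sets C_n containing all x_k + x_m / (k + 1) with m >= n, and satisfying
   phi_j + (j + 1) phi_N >= d for j <= N <= n and phi_j -> 0, have empty
   intersection, while x_k is at distance O(1 / k) from every C_n.
   (c) => (b): take f = sup_n dist(., C_n) / (n + 1).
   (b) => (a): in a reflexive space a positive continuous convex f is bounded
   away from 0 on bounded sets, so 1/f becomes convex after adding K(f + norm)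
   for a convex K : R -> R growing fast enough.
   (c) => (a): nested nonempty bounded closed convex subsets of a reflexive
   space have a common point. *)

(** * Hahn-Banach *)

Section HahnBanach.
Context {R : realType} {V : lmodType R}.
Implicit Types (p q f : V -> R) (u v w : V).

Definition sublinear p :=
  (forall v w, p (v + w) <= p v + p w) /\
  (forall (t : R) v, 0 <= t -> p (t *: v) = t * p v).

Definition linear_form f := forall (a : R) v w, f (a *: v + w) = a * f v + f w.

Lemma linear_form0 f : linear_form f -> f 0 = 0.
Proof. by move=> /(_ 1 0 0); rewrite scale1r addr0; lra. Qed.

Lemma linear_formZ f (a : R) v : linear_form f -> f (a *: v) = a * f v.
Proof. by move=> fl; rewrite -[a *: v]addr0 fl linear_form0// addr0. Qed.

Lemma linear_formD f v w : linear_form f -> f (v + w) = f v + f w.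
Proof. by move=> fl; rewrite -[v]scale1r fl scale1r mul1r. Qed.

Lemma linear_formN f v : linear_form f -> f (- v) = - f v.
Proof. by move=> fl; rewrite -scaleN1r linear_formZ// mulN1r. Qed.

Lemma linear_formB f v w : linear_form f -> f (v - w) = f v - f w.
Proof. by move=> fl; rewrite linear_formD// linear_formN. Qed.

(** Applying the inequality for [t^-1] to [t *: v] gives the reverse inequality, so one-sided
    homogeneity is enough. *)
Lemma sublinearI p :
  (forall v w, p (v + w) <= p v + p w) -> p 0 <= 0 ->
  (forall (t : R) v, 0 < t -> p (t *: v) <= t * p v) -> sublinear p.
Proof.
move=> pD p0 pZ; split=> // t v; rewrite le_eqVlt => /predU1P[<-|t0].
  rewrite scale0r mul0r; apply/eqP; rewrite eq_le p0 /=.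
  by have := pD 0 0; rewrite addr0; lra.
apply/eqP; rewrite eq_le pZ //=.
have := pZ t^-1 (t *: v); rewrite invr_gt0 scalerA mulVf ?gt_eqF// scale1r.
by move=> /(_ t0); rewrite ler_pdivlMl.
Qed.

Lemma sublinear0 p : sublinear p -> p 0 = 0.
Proof. by move=> [_ pZ]; rewrite -(scale0r 0) pZ// mul0r. Qed.

Lemma sublinear_ge p v : sublinear p -> - p (- v) <= p v.
Proof.
by move=> ps; have [pD _] := ps; have := pD v (- v);
  rewrite subrr (sublinear0 ps); lra.
Qed.

(** Common source of the sublinear functions in this section: the perturbation of a minimal one, the
    infimum of a chain, and the directional derivative. The bound [lb] makes each [inf] a genuine
    infimum. *)
Lemma sublinear_inf (S : V -> set R) (lb : V -> R) :
  (forall v, S v !=set0) -> (forall v, lbound (S v) (lb v)) ->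
  (forall v w a b, S v a -> S w b -> exists2 c, S (v + w) c & c <= a + b) ->
  (exists2 c, S 0 c & c <= 0) ->
  (forall (t : R) v a, 0 < t -> S v a -> exists2 c, S (t *: v) c & c <= t * a) ->
  sublinear (fun v => inf (S v)).
Proof.
move=> S0 Slb SD [c0 Sc0 c00] SZ.
have hlb v : has_lbound (S v) by exists (lb v).
apply: sublinearI.
- move=> v w; rewrite -lerBlDr; apply: lb_le_inf => // a Sa.
  rewrite lerBlDr -lerBlDl; apply: lb_le_inf => // b Sb.
  rewrite lerBlDl; have [c Sc cab] := SD _ _ _ _ Sa Sb.
  exact: le_trans (ge_inf (hlb _) Sc) cab.
- exact: le_trans (ge_inf (hlb _) Sc0) c00.
- move=> t v t0; rewrite -ler_pdivrMl//; apply: lb_le_inf => // a Sa.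
  rewrite ler_pdivrMl//; have [c Sc cab] := SZ _ _ _ t0 Sa.
  exact: le_trans (ge_inf (hlb _) Sc) cab.
Qed.

(* Given a minimal sublinear [p] and [w], the sublinear function
   [v |-> inf_(t >= 0) (p (v + t w) - t p w)] is below [p], hence equals [p];
   its value at [t = 1] yields superadditivity. *)
Lemma minimal_sublinear_linear p :
  sublinear p -> (forall q, sublinear q -> (forall v, q v <= p v) -> q = p) ->
  linear_form p.
Proof.
move=> ps pmin; have [pD pZ] := ps.
have padd v w : p (v + w) = p v + p w.
  pose S u := [set p (u + t *: w) - t * p w | t in [set t : R | 0 <= t]].
  have Slb u : lbound (S u) (- p (- u)).
    move=> _ [t /= t0 <-]; have := pD (u + t *: w) (- u).
    by rewrite addrAC subrr add0r pZ//; lra.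
  have qs : sublinear (fun u => inf (S u)).
    apply: (@sublinear_inf _ (fun u => - p (- u))) => //.
    - by move=> u; exists (p (u + 0 *: w) - 0 * p w), 0 => /=.
    - move=> u1 u2 _ _ [s /= s0 <-] [t /= t0 <-].
      exists (p (u1 + u2 + (s + t) *: w) - (s + t) * p w).
        by exists (s + t) => //=; exact: addr_ge0.
      have -> : u1 + u2 + (s + t) *: w = (u1 + s *: w) + (u2 + t *: w).
        by rewrite scalerDl addrACA.
      by rewrite mulrDl; have := pD (u1 + s *: w) (u2 + t *: w); lra.
    - exists (p (0 + 0 *: w) - 0 * p w); first by exists 0 => /=.
      by rewrite scale0r addr0 mul0r sublinear0// subr0.
    - move=> t u _ t0 [s /= s0 <-].
      exists (p (t *: u + (t * s) *: w) - t * s * p w).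
        by exists (t * s) => //=; rewrite mulr_ge0// ltW.
      by rewrite -scalerA -scalerDr pZ ?(ltW t0)// mulrBr mulrA.
  have qE := pmin _ qs.
  have {}qE : (fun u => inf (S u)) = p.
    apply: qE => u; apply: (@ge_inf _ (S u)); first by exists (- p (- u)).
    by exists 0 => //=; rewrite scale0r addr0 mul0r subr0.
  apply/eqP; rewrite eq_le pD/=.
  suff : p v <= p (v + w) - p w by lra.
  rewrite -[in leLHS]qE; apply: (@ge_inf _ (S v)); first by exists (- p (- v)).
  by exists 1 => //=; rewrite scale1r mul1r.
move=> a v w; rewrite padd; congr (_ + _).
have [a0|/ltW a0] := leP 0 a; first exact: pZ.
have : p (a *: v) + p (- a *: v) = 0.
  by rewrite -padd -scalerDl subrr scale0r sublinear0.
by rewrite (pZ (- a)) ?oppr_ge0//; lra.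
Qed.

Lemma sublinear_ge_linear p :
  sublinear p -> exists2 f, linear_form f & forall v, f v <= p v.
Proof.
move=> ps.
pose T := {q | sublinear q /\ forall v, q v <= p v}.
(* The order is reversed, so a maximal element for [rel] is a pointwise minimal sublinear function
   below [p], hence linear. *)
pose rel (q1 q2 : T) := `[< forall v, sval q2 v <= sval q1 v >].
have [|q1 q2 q3 /asboolP h1 /asboolP h2|[q1 q1P] [q2 q2P] /asboolP h1 /asboolP h2||] :=
  @Zorn T rel.
- by move=> q; apply/asboolP.
- by apply/asboolP => v; exact: le_trans (h2 v) (h1 v).
- by apply: eq_exist; apply/funext => v; apply/eqP; rewrite eq_le h1 h2.
- move=> A Atot; have [[q0 Aq0]|A0] := pselect (exists q : T, A q); last first.
    by exists (exist _ p (conj ps (fun v => lexx _))) => q Aq; case: A0; exists q.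
  pose S v := [set sval (q : T) v | q in A].
  (* This bound is uniform over the chain: [q v >= - q (- v) >= - p (- v)] for every sublinear [q]
     below [p]. *)
  have Slb v : lbound (S v) (- p (- v)).
    move=> _ [[q [qs qp]] /= Aq <-]; apply: le_trans (sublinear_ge v qs).
    by rewrite lerN2.
  have Sinf (q : T) v : A q -> inf (S v) <= sval q v.
    by move=> Aq; apply: ge_inf; [exists (- p (- v))|exists q].
  have qs : sublinear (fun v => inf (S v)).
    apply: (sublinear_inf _ Slb).
    - by move=> v; exists (sval q0 v), q0.
    - move=> v w _ _ [q1 Aq1 <-] [q2 Aq2 <-].
      have [/asboolP h|/asboolP h] := Atot _ _ Aq1 Aq2.
        exists (sval q2 (v + w)); first by exists q2.
        by apply: le_trans ((svalP q2).1.1 v w) _; rewrite lerD2r.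
      exists (sval q1 (v + w)); first by exists q1.
      by apply: le_trans ((svalP q1).1.1 v w) _; rewrite lerD2l.
    - by exists (sval q0 0); [exists q0|rewrite (sublinear0 (svalP q0).1)].
    - move=> t v _ t0 [q Aq <-]; exists (sval q (t *: v)); first by exists q.
      by rewrite (svalP q).1.2 ?(ltW t0).
  have qp v : inf (S v) <= p v := le_trans (Sinf q0 v Aq0) ((svalP q0).2 v).
  exists (exist _ (fun v => inf (S v)) (conj qs qp)) => q Aq.
  by apply/asboolP => v /=; exact: Sinf.
- move=> [q [qs qp]] qmin; exists q => //.
  apply: minimal_sublinear_linear => // q' q's q'q.
  have q'p v : q' v <= p v := le_trans (q'q v) (qp v).
  have /(_ (asboolT q'q))[] := qmin (exist _ q' (conj q's q'p)).
  by [].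
Qed.

(* The directional derivative of [h] at [x] is sublinear. *)
Lemma convex_subgradient (h lb : V -> R) x :
  (forall (t : R) v w, 0 <= t <= 1 ->
     h (t *: v + (1 - t) *: w) <= t * h v + (1 - t) * h w) ->
  (forall (t : R) v, 0 < t -> t * lb v <= h (x + t *: v) - h x) ->
  exists2 f, linear_form f & forall v, f v <= h (x + v) - h x.
Proof.
move=> hconv hlb.
pose S v := [set (h (x + t *: v) - h x) / t | t in [set t : R | 0 < t]].
have Slb v : lbound (S v) (lb v).
  by move=> _ [t /= t0 <-]; rewrite ler_pdivlMr// mulrC hlb.
have ps : sublinear (fun v => inf (S v)).
  apply: (sublinear_inf _ Slb).
  - by move=> v; exists ((h (x + 1 *: v) - h x) / 1), 1 => /=.
  - move=> v w _ _ [s /= s0 <-] [t /= t0 <-].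
    have st0 : 0 < s + t by rewrite addr_gt0.
    (* With this [r], the point [x + r (v + w)] is the convex combination of [x + s v] and [x + t w]
       with weights [t / (s + t)] and [s / (s + t)]. *)
    pose r := s * t / (s + t).
    have r0 : 0 < r by rewrite divr_gt0// mulr_gt0.
    exists ((h (x + r *: (v + w)) - h x) / r); first by exists r.
    have := hconv (t / (s + t)) (x + s *: v) (x + t *: w).
    have -> : 1 - t / (s + t) = s / (s + t) by field; rewrite gt_eqF.
    rewrite !scalerDr addrACA -scalerDl -mulrDl (addrC t) divff ?gt_eqF// scale1r.
    rewrite !scalerA mulrAC (mulrAC s) (mulrC t s) -/r -scalerDr.
    have -> : 0 <= t / (s + t) <= 1.
      by rewrite ler_pdivrMr// mul1r lerDr (ltW s0) andbT divr_ge0// ltW.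
    move=> /(_ isT) hr; rewrite ler_pdivrMr// lerBlDr.
    apply: le_trans hr _; rewrite le_eqVlt; apply/orP; left; apply/eqP.
    by rewrite /r; field; rewrite !gt_eqF.
  - exists ((h (x + 1 *: 0) - h x) / 1); first by exists 1 => /=.
    by rewrite scaler0 addr0 subrr mul0r.
  - move=> t v _ t0 [s /= s0 <-].
    exists ((h (x + (s / t) *: (t *: v)) - h x) / (s / t)).
      by exists (s / t) => //=; rewrite divr_gt0.
    by rewrite scalerA divfK ?gt_eqF// invf_div mulrC mulrAC mulrA.
have [f flin fp] := sublinear_ge_linear ps.
exists f => // v; apply: le_trans (fp v) _; apply: ge_inf; first by exists (lb v).
by exists 1 => //=; rewrite scale1r divr1.
Qed.

End HahnBanach.

(** * Domination modulo finitely many linear functionals *)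

Section Helly.
Context {R : realType} {V : lmodType R}.
Implicit Types (p f l : V -> R) (W : set V).

(** Linearity and sublinearity are relativised to a subset so that they apply to the dual, which is
    the subset [in_dual] of the module of all functions [X -> R^o]. *)
Definition linear_subspace W :=
  W 0 /\ forall (a : R) v w, W v -> W w -> W (a *: v + w).

Definition linear_on W f :=
  forall (a : R) v w, W v -> W w -> f (a *: v + w) = a * f v + f w.

Definition sublinear_on W p :=
  (forall v w, W v -> W w -> p (v + w) <= p v + p w) /\
  (forall (t : R) v, 0 < t -> W v -> p (t *: v) = t * p v).

Section subspace_lemmas.
Variables (W : set V) (WW : linear_subspace W).

Lemma subspaceZ (a : R) v : W v -> W (a *: v).
Proof. by case: WW => W0 WL Wv; rewrite -[_ *: _]addr0; exact: WL. Qed.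

Lemma subspaceD v w : W v -> W w -> W (v + w).
Proof. by case: WW => W0 WL Wv Ww; rewrite -[v]scale1r; exact: WL. Qed.

Lemma linear_on0 f : linear_on W f -> f 0 = 0.
Proof.
case: WW => W0 _ /(_ 1 0 0 W0 W0); rewrite scale1r addr0 mul1r; lra.
Qed.

Lemma linear_onZ f (a : R) v : linear_on W f -> W v -> f (a *: v) = a * f v.
Proof.
move=> fl Wv; case: (WW) => W0 _.
by rewrite -[a *: v]addr0 fl// linear_on0// addr0.
Qed.

Lemma linear_onD f v w : linear_on W f -> W v -> W w -> f (v + w) = f v + f w.
Proof. by move=> fl Wv Ww; rewrite -[v]scale1r fl// scale1r mul1r. Qed.

End subspace_lemmas.

(** This is the one-dimensional Hahn-Banach extension step. With [l e = 1], the restriction of [f]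
    to the kernel of [l] is extended by a value [b] at [e]; the extension differs from [f] by the
    multiple [f e - b] of [l]. *)
Lemma dominated_on_kernel W p f l :
  linear_subspace W -> sublinear_on W p -> linear_on W f -> linear_on W l ->
  (forall v, W v -> l v = 0 -> f v <= p v) ->
  exists a : R, forall v, W v -> f v - a * l v <= p v.
Proof.
move=> WW [pD pZ] fl ll fp.
have [l0|] := pselect (forall v, W v -> l v = 0).
  by exists 0 => v Wv; rewrite mul0r subr0; apply: fp => //; exact: l0.
move=> /existsNP[e' /not_implyP[We' le'0]].
pose e := (l e')^-1 *: e'.
have We : W e by exact: subspaceZ.
have le1 : l e = 1 by rewrite /e (linear_onZ WW)// mulVf//; exact/eqP.
pose K u := W u /\ l u = 0.
have K0 : K 0 by split; [case: WW|exact: (linear_on0 WW)].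
have WNe : W (- e) by rewrite -scaleN1r; exact: subspaceZ.
have KZ a u : K u -> K (a *: u).
  by move=> [Wu lu]; split; [exact: subspaceZ|rewrite (linear_onZ WW)// lu mulr0].
pose S := [set f u - p (u - e) | u in K].
(* Every lower constraint on [b], coming from points [u - e], lies below every upper constraint,
   coming from points [w + e]. *)
have Sub w : K w -> ubound S (p (w + e) - f w).
  move=> [Ww lw] _ [u [Wu lu] <-].
  have Wuw : W (u + w) by exact: subspaceD.
  have := fp (u + w) Wuw; rewrite (linear_onD fl)// (linear_onD ll)// lu lw addr0.
  move=> /(_ erefl).
  have := pD (u - e) (w + e) (subspaceD WW Wu WNe) (subspaceD WW Ww We).
  by rewrite addrACA addNr addr0; lra.
have Shs : has_ubound S by exists (p (0 + e) - f 0); exact: Sub.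
pose b := sup S.
exists (f e - b) => v Wv.
pose u := v - l v *: e.
have Ku : K u.
  split; first by rewrite /u addrC -scaleNr; case: WW => _; exact.
  by rewrite /u addrC -scaleNr ll// le1; lra.
have Ww := Ku.1.
have vE : v = l v *: e + u by rewrite /u addrCA subrr addr0.
have fv : f v = l v * f e + f u by rewrite {1}vE fl.
(* Dividing by the absolute value of [l v] brings [v] to the form [u' - e] or [u' + e] with [u'] in
   the kernel, where the constraints on [b] apply. *)
have [lv0|lv0|lv0] := ltgtP (l v) 0.
- have t0 : 0 < - l v by rewrite oppr_gt0.
  have tn0 : - l v != 0 by rewrite gt_eqF.
  have : S (f ((- l v)^-1 *: u) - p ((- l v)^-1 *: u - e)).
    by exists ((- l v)^-1 *: u) => //; exact: KZ.
  move=> /(ub_le_sup Shs); rewrite -/b.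
  have -> : (- l v)^-1 *: u - e = (- l v)^-1 *: v.
    by rewrite /u scalerBr scalerA invrN mulNr mulVf ?lt_eqF// scaleN1r opprK addrK.
  rewrite pZ ?invr_gt0// (linear_onZ WW)// -mulrBr ler_pdivrMl//.
  by rewrite fv; lra.
- have : b <= p ((l v)^-1 *: u + e) - f ((l v)^-1 *: u).
    apply: ge_sup; first by exists (f 0 - p (0 - e)), 0.
    by apply: Sub; exact: KZ.
  have -> : (l v)^-1 *: u + e = (l v)^-1 *: v.
    by rewrite /u scalerBr scalerA mulVf ?gt_eqF// scale1r subrK.
  rewrite pZ ?invr_gt0// (linear_onZ WW)// -mulrBr ler_pdivlMl//.
  by rewrite fv; lra.
- by rewrite lv0 mulr0 subr0; exact: fp.
Qed.

(** Induction on [n], passing to the kernel of the last functional. The class [G] records what is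
    known of linear combinations of the [l i]: evaluations at points of [X] in one application,
    functionals annihilated by [Phi] in the other. *)
Lemma dominated_on_kernels (G : set (V -> R)) W p f (l : nat -> V -> R) n :
  G (fun=> 0) ->
  (forall (a : R) g h, G g -> G h -> G (fun v => a * g v + h v)) ->
  (forall g, G g -> linear_on W g) ->
  (forall i, (i < n)%N -> G (l i)) ->
  linear_subspace W -> sublinear_on W p -> linear_on W f ->
  (forall v, W v -> (forall i, (i < n)%N -> l i v = 0) -> f v <= p v) ->
  exists2 g, G g & forall v, W v -> f v - g v <= p v.
Proof.
move=> G0 GL; elim: n W => [|n IH] W Glin Gl WW ps fl fp.
  by exists (fun=> 0) => // v Wv; rewrite subr0; exact: fp.
have Gln := Gl n (ltnSn n); have lnl := Glin _ Gln.
pose W' : set V := [set v | W v /\ l n v = 0].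
have [|i i_n| |||v [Wv lnv] lv|g Gg fg] := IH W'.
- by move=> g Gg a v w [Wv _] [Ww _]; exact: Glin.
- by apply: Gl; exact: ltnW.
- split; first by split; [case: WW|exact: (linear_on0 WW)].
  move=> a v w [Wv lv] [Ww lw]; split; first by case: WW => _; exact.
  by rewrite lnl// lv lw mulr0 addr0.
- by split=> [v w [Wv _] [Ww _]|t v t0 [Wv _]]; [exact: ps.1|exact: ps.2].
- by move=> a v w [Wv _] [Ww _]; exact: fl.
- apply: fp => // i; rewrite ltnS leq_eqVlt => /predU1P[->//|]; exact: lv.
have gl := Glin _ Gg.
have [||a fa] := @dominated_on_kernel W p (fun v => f v - g v) (l n) WW ps _ lnl.
- by move=> a v w Wv Ww; rewrite fl// gl//; ring.
- by move=> v Wv lv; exact: fg.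
exists (fun v => a * l n v + g v); first exact: GL.
by move=> v Wv; have := fa v Wv; lra.
Qed.

End Helly.

(** * Distance functions, separation and reflexivity *)

Section Normed.
Context {R : realType} {X : normedModType R}.
Implicit Types (f h : X -> R) (C : set X) (x y : X).

Lemma lipschitz_continuous f (c : R) :
  (forall x y, `|f x - f y| <= c * `|x - y|) -> continuous f.
Proof.
move=> fc x; apply/cvgrPdist_le => e e0.
have d0 : 0 < `|c| + 1 by rewrite ltr_wpDl.
near=> y; apply: le_trans (fc x y) _.
apply: (@le_trans _ _ ((`|c| + 1) * `|x - y|)).
  by rewrite ler_wpM2r// (le_trans (ler_norm c))// lerDl.
rewrite -ler_pdivlMl// mulrC.
near: y; apply: cvgr_dist_le; last by rewrite divr_gt0.
exact: cvg_id.
Unshelve. all: by end_near. Qed.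

Lemma convex_functionP f :
  convex_function (R := R) (E := X) setT f <->
  forall (t : R) x y, 0 <= t <= 1 ->
    f (t *: x + (1 - t) *: y) <= t * f x + (1 - t) * f y.
Proof.
split=> [fconv t x y /andP[t0 t1]|fconv t x y _ _].
  have i01 : t = (Itv01 t0 t1)%:num by [].
  by have := fconv (Itv01 t0 t1) x y; rewrite !inE => /(_ Logic.I Logic.I).
by apply: fconv; rewrite ge0 le1.
Qed.

Lemma convex_setP C :
  convex_set (R := R) (M := X) C <->
  forall (t : R) x y, 0 <= t <= 1 -> C x -> C y -> C (t *: x + (1 - t) *: y).
Proof.
split=> [Cconv t x y /andP[t0 t1] Cx Cy|Cconv x y t].
  by have := Cconv x y (Itv01 t0 t1); rewrite !inE; apply.
by rewrite !inE => Cx Cy; apply: Cconv => //; rewrite ge0 le1.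
Qed.

Lemma in_dual_bounded_linear f (c : R) :
  linear_form f -> (forall x, `|f x| <= c * `|x|) -> in_dual f.
Proof.
move=> flin fc; split=> //; apply: (@lipschitz_continuous _ c) => x y.
by rewrite -(linear_formB _ _ flin).
Qed.

Lemma in_dual_linear_on W f : in_dual f -> linear_on W f.
Proof. by move=> [flin _] a x y _ _; exact: flin. Qed.

Lemma dual_norm_ex f : in_dual f -> exists c, dual_norm_le f c.
Proof.
move=> [flin fcont].
have f0 := linear_form0 flin.
have fZ (a : R) x := linear_formZ a x flin.
have /cvgrPdist_le/(_ 1 ltr01)/nbhs_ballP[d /= d0 fd] := fcont 0.
exists (2 / d); split; first by rewrite divr_ge0// ltW.
move=> x; have [->|x0] := eqVneq x 0; first by rewrite f0 !normr0 mulr0.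
have nx0 : 0 < `|x| by rewrite normr_gt0.
(* Scaling by [a] gives norm [d / 2], strictly inside the ball where [f] is at most 1 in absolute
   value. *)
pose a := d / 2 / `|x|.
have a0 : 0 < a by rewrite !divr_gt0.
have := fd (a *: x); rewrite /= f0 sub0r normrN fZ normrM (gtr0_norm a0).
rewrite -ball_normE /= sub0r normrN normrZ (gtr0_norm a0) divfK ?gt_eqF//.
rewrite -ler_pdivlMl// /a mulr1 !invf_div => h.
by rewrite mulrC; apply: h; rewrite ltr_pdivrMr//; lra.
Qed.

(** A subgradient of a 1-Lipschitz convex function has norm at most 1. It is applied to the norm and
    to the distance to a convex set. *)
Lemma support_functional h x :
  (forall (t : R) v w, 0 <= t <= 1 ->
     h (t *: v + (1 - t) *: w) <= t * h v + (1 - t) * h w) ->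
  (forall v w, `|h v - h w| <= `|v - w|) ->
  exists f, [/\ in_dual f, dual_norm_le f 1 & forall v, f v <= h (x + v) - h x].
Proof.
move=> hconv h1.
have [t v t0|f flin fh] := @convex_subgradient _ _ h (fun v => - `|v|) x hconv.
  have := h1 (x + t *: v) x; rewrite (addrC x) addrK normrZ (gtr0_norm t0).
  by rewrite ler_norml mulrN => /andP[].
have fN v := linear_formN v flin.
have fle v : f v <= `|v|.
  apply: le_trans (fh v) _; apply: le_trans (ler_norm _) _.
  by apply: le_trans (h1 _ _) _; rewrite addrC addKr.
have f1 v : `|f v| <= 1 * `|v|.
  by rewrite mul1r ler_norml lerNl -fN -[in X in X && _](normrN v) !fle.
by exists f; split => //; exact: (in_dual_bounded_linear flin f1).
Qed.

(** A subgradient of the norm at [x], tested in the direction [- x], takes at least the value of the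
    norm at [x]. *)
Lemma norming_functional x :
  exists f, [/\ in_dual f, dual_norm_le f 1 & f x = `|x|].
Proof.
have [t v w /andP[t0 t1]|v w|f [fd f1 fx]] := @support_functional (fun v => `|v|) x.
- apply: le_trans (ler_normD _ _) _.
  by rewrite !normrZ !ger0_norm// subr_ge0.
- exact: ler_dist_dist.
exists f; split => //; apply/eqP; rewrite eq_le; apply/andP; split.
  by have := f1.2 x; rewrite mul1r; exact: le_trans (ler_norm _).
have := fx (- x); rewrite subrr normr0 sub0r.
by rewrite (linear_formN _ fd.1) lerN2.
Qed.

Definition distance C x : R := inf [set `|x - c| | c in C].

Lemma distance_lb C x : lbound [set `|x - c| | c in C] 0.
Proof. by move=> _ [c _ <-]. Qed.

Lemma distance_le C x c : C c -> distance C x <= `|x - c|.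
Proof. by move=> Cc; apply: ge_inf; [exists 0; exact: distance_lb|exists c]. Qed.

Lemma le_distance C x (a : R) : C !=set0 ->
  (forall c, C c -> a <= `|x - c|) -> a <= distance C x.
Proof.
move=> [c0 Cc0] aC; apply: lb_le_inf; first by exists `|x - c0|, c0.
by move=> _ [c Cc <-]; exact: aC.
Qed.

Lemma distance_ge0 C x : C !=set0 -> 0 <= distance C x.
Proof. by move=> C0; apply: le_distance. Qed.

Lemma distance_mem C x : C x -> distance C x = 0.
Proof.
move=> Cx; apply/eqP; rewrite eq_le distance_ge0 ?andbT; last by exists x.
by rewrite (le_trans (distance_le x Cx))// subrr normr0.
Qed.

Lemma distance_near C x (e : R) : C !=set0 -> distance C x < e ->
  exists2 c, C c & `|x - c| < e.
Proof.
move=> C0 dxe; apply: contrapT => nC.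
suff : e <= distance C x by rewrite leNgt dxe.
apply: le_distance => // c Cc; rewrite leNgt; apply/negP => xc.
by apply: nC; exists c.
Qed.

Lemma distance_gt0 C x : C !=set0 -> closed C -> ~ C x -> 0 < distance C x.
Proof.
move=> C0 Ccl nCx; rewrite lt_neqAle distance_ge0// andbT eq_sym.
apply/negP => /eqP dx0; apply: nCx; apply: Ccl => B /nbhs_ballP[e /= e0 eB].
have [|c Cc xc] := @distance_near C x e C0; first by rewrite dx0.
by exists c; split => //; apply: eB; rewrite -ball_normE.
Qed.

Lemma distance_lipschitz C x y : C !=set0 ->
  `|distance C x - distance C y| <= `|x - y|.
Proof.
move=> C0; have dle u v : distance C u - distance C v <= `|u - v|.
  rewrite lerBlDl -lerBlDr; apply: le_distance => // c Cc.
  rewrite lerBlDr; apply: le_trans (distance_le u Cc) _.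
  by rewrite [leRHS]addrC -[u - c](subrKA v) ler_normD.
rewrite ler_norml dle andbT lerNl opprB.
by rewrite (le_trans (dle y x))// distrC.
Qed.

Lemma distance_convex C (t : R) x y : C !=set0 ->
  convex_set (R := R) (M := X) C -> 0 <= t <= 1 ->
  distance C (t *: x + (1 - t) *: y) <= t * distance C x + (1 - t) * distance C y.
Proof.
move=> C0 /convex_setP Cconv t01; have /andP[t0 t1] := t01.
apply/ler_addgt0Pr => e e0.
have [|c Cc xc] := @distance_near C x (distance C x + e) C0; first by rewrite ltrDl.
have [|d Cd yd] := @distance_near C y (distance C y + e) C0; first by rewrite ltrDl.
apply: le_trans (distance_le _ (Cconv t c d t01 Cc Cd)) _.
have -> : t *: x + (1 - t) *: y - (t *: c + (1 - t) *: d) =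
    t *: (x - c) + (1 - t) *: (y - d) by rewrite !scalerBr opprD addrACA.
apply: le_trans (ler_normD _ _) _; rewrite !normrZ !ger0_norm ?subr_ge0//.
have h1 := ler_wpM2l t0 (ltW xc).
have s0 : 0 <= 1 - t by rewrite subr_ge0.
have h2 := ler_wpM2l s0 (ltW yd).
by apply: le_trans (lerD h1 h2) _; rewrite !mulrDr; lra.
Qed.

(** A subgradient at [x] of the distance to [C] separates, with gap equal to the distance from [x],
    because the distance vanishes on [C]. *)
Lemma separation C x : C !=set0 -> closed C ->
  convex_set (R := R) (M := X) C -> ~ C x ->
  exists f (d : R), [/\ in_dual f, 0 < d & forall c, C c -> f c <= f x - d].
Proof.
move=> C0 Ccl Cconv nCx.
have [t v w|v w|f [fd _ fx]] := @support_functional (distance C) x.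
- exact: distance_convex.
- exact: distance_lipschitz.
exists f, (distance C x); split => //; first exact: distance_gt0.
move=> c Cc; have := fx (c - x).
rewrite addrCA subrr addr0 (distance_mem Cc) sub0r.
by rewrite (linear_formB _ _ fd.1); lra.
Qed.

End Normed.

(** If a proper filter finer than the image contains [A], the ultrafilter cannot contain the
    complement of the preimage of [A]. *)
Lemma ultra_fmap (S T : Type) (g : S -> T) (U : set_system S) :
  UltraFilter U -> UltraFilter (g @ U).
Proof.
move=> UU; split => [|G GP UG]; first exact: fmap_proper_filter.
apply/seteqP; split => // A GA.
have [//|UC] := in_ultra_setVsetC (g @^-1` A) UU.
have GC : G (~` A) by apply: UG.
have : G (A `&` ~` A) by exact: filterI.
by rewrite setICr => /(filter_not_empty G).
Qed.

Section ReflexiveNested.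
Context {R : realType} {X : normedModType R}.

(* The limit along an ultrafilter of the evaluations at points [x n] of [C n]
   is a functional on the dual, whose representing point lies in every [C n]. *)
Lemma reflexive_nested (C : nat -> set X) : reflexive_space (X := X) ->
  (forall n, C n !=set0) -> bounded_subset (C 0%N) ->
  (forall n, closed (C n)) ->
  (forall n, convex_set (R := R) (M := X) (C n)) ->
  (forall n, C n.+1 `<=` C n) ->
  exists x, forall n, C n x.
Proof.
move=> Xrefl C0 [M CM] Ccl Cconv Cdec.
have Cmono m n : (m <= n)%N -> C n `<=` C m.
  move=> /subnK <-; elim: (n - m)%N => // k IH y; rewrite addSn => /Cdec; exact: IH.
have [x Cx] := choice C0.
have xM n : `|x n| <= M by apply: CM; apply: (Cmono 0%N n).
have M0 : 0 <= M by exact: le_trans (normr_ge0 _) (xM 0%N).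
have [U [UU ooU]] := ultraFilterLemma (F := \oo) _.
(* The values [f (x n)] stay in a compact segment, so they converge along the ultrafilter. *)
have fxc (f : X -> R) : in_dual f -> cvg (f \o x @ U).
  move=> /dual_norm_ex[c [c0 fc]].
  have fB n : `|f (x n)| <= c * M by rewrite (le_trans (fc _))// ler_wpM2l.
  have fU : (f \o x @ U) `[- (c * M), c * M]%classic.
    by apply: (@filterE _ U) => n /=; rewrite in_itv /= -ler_norml; exact: fB.
  have := @segment_compact R (- (c * M)) (c * M).
  rewrite compact_ultra => /(_ (f \o x @ U) (ultra_fmap _ UU) fU).
  by move=> [l [_ fl]]; apply/cvg_ex; exists l.
pose Phi (f : X -> R) : R := lim (f \o x @ U).
have [|y Phiy] := Xrefl Phi.
  split=> [a f g fd gd|].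
    apply/cvg_lim => //.
    by apply: cvgD; [apply: cvgM; [exact: cvg_cst|]|]; exact: fxc.
  exists M => f c fd [c0 fc].
  have fB n : `|f (x n)| <= M * c by rewrite mulrC (le_trans (fc _))// ler_wpM2l.
  rewrite ler_norml; apply/andP; split.
    apply: limr_ge; first exact: fxc.
    by apply: filterE => n /=; have := fB n; rewrite ler_norml => /andP[].
  apply: limr_le; first exact: fxc.
  by apply: filterE => n /=; have := fB n; rewrite ler_norml => /andP[].
exists y => n; apply: contrapT => nCy.
have [f [d [fd d0 fC]]] := separation (C0 n) (Ccl n) (Cconv n) nCy.
(* The ultrafilter refines [\oo] and [x k] lies in [C n] for [k >= n], so the separating inequality
   passes to the limit. *)
have : Phi f <= f y - d.
  apply: limr_le; first exact: fxc.
  apply: ooU; exists n => // k /= nk; apply: fC; exact: (Cmono n k).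
by rewrite (Phiy f fd); lra.
Qed.

End ReflexiveNested.

(** * James sequences *)

Section Bidual.
Context {R : realType} {X : normedModType R}.
Implicit Types (f g : X -> R) (Phi : (X -> R) -> R) (x y : X).

Definition dual_norm f : R := inf [set c | dual_norm_le f c].

Lemma dual_norm_min f (c : R) : dual_norm_le f c -> dual_norm f <= c.
Proof. by move=> fc; apply: ge_inf => //; exists 0 => a []. Qed.

Lemma dual_normP f : in_dual f -> dual_norm_le f (dual_norm f).
Proof.
move=> /dual_norm_ex fc; split; first by apply: lb_le_inf => // a [].
move=> x; have [->|x0] := eqVneq x 0.
  by have [c [_ /(_ 0)]] := fc; rewrite !normr0 !mulr0.
rewrite -ler_pdivrMr ?normr_gt0//; apply: lb_le_inf => // c [_ cf].
by rewrite ler_pdivrMr ?normr_gt0.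
Qed.

Lemma in_dualL (a : R) f g : in_dual f -> in_dual g ->
  in_dual (fun x => a * f x + g x).
Proof.
move=> [flin fcont] [glin gcont]; split.
  by move=> b x y; rewrite flin glin; ring.
by move=> x; apply: cvgD; [apply: cvgM; [exact: cvg_cst|exact: fcont]|exact: gcont].
Qed.

Lemma in_dual0 : in_dual (fun _ : X => 0 : R).
Proof. by split; [move=> a x y; rewrite mulr0 addr0|move=> x; exact: cvg_cst]. Qed.

Lemma dual_linear_subspace : linear_subspace (V := X -> R^o) in_dual.
Proof. by split; [exact: in_dual0|exact: in_dualL]. Qed.

Lemma bidual_linear_on Phi :
  in_bidual Phi -> linear_on (V := X -> R^o) in_dual Phi.
Proof. by move=> [Philin _] a f g; exact: Philin. Qed.

Lemma dual_normZ_le f (c t : R) : dual_norm_le f c ->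
  dual_norm_le (fun x => t * f x) (`|t| * c).
Proof.
move=> [c0 fc]; split; first exact: mulr_ge0.
by move=> x; rewrite normrM -mulrA ler_wpM2l.
Qed.

Lemma dual_norm_sublinear (d : R) : 0 <= d ->
  sublinear_on (V := X -> R^o) in_dual (fun f => d * dual_norm f).
Proof.
move=> d0; have nZ t f : 0 < t -> in_dual f ->
    dual_norm (fun x => t * f x) <= t * dual_norm f.
  move=> t0 /dual_normP/(dual_normZ_le t)/dual_norm_min.
  by rewrite gtr0_norm.
split=> [f g /dual_normP[f0 fle] /dual_normP[g0 gle]|t f t0 fd].
  rewrite -mulrDr ler_wpM2l//; apply: dual_norm_min; split; first exact: addr_ge0.
  by move=> x; rewrite mulrDl (le_trans (ler_normD _ _))// lerD.
rewrite mulrCA; congr (_ * _); apply/eqP; rewrite eq_le nZ//=.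
have tfd : in_dual (fun x => t * f x).
  exact: (@subspaceZ _ (X -> R^o) _ dual_linear_subspace t f fd).
rewrite -ler_pdivlMl//; apply: le_trans (nZ _ _ _ tfd); last by rewrite invr_gt0.
rewrite le_eqVlt; apply/orP; left; apply/eqP; congr dual_norm; apply/funext => x.
by rewrite mulrA mulVf ?mul1r// gt_eqF.
Qed.

End Bidual.

(** * James' construction for an unrepresented bidual functional *)

Section James.
Context {R : realType} {X : completeNormedModType R}.
Variables (Phi : (X -> R) -> R).
Hypothesis PhiB : in_bidual Phi.
Hypothesis Phi_notin : ~ exists x : X, forall f, in_dual f -> Phi f = f x.

Let PhiZ (a : R) f : in_dual f -> Phi (fun x => a * f x) = a * Phi f.
Proof.
move=> fd; have Phil := bidual_linear_on PhiB.
exact: (linear_onZ (V := X -> R^o) dual_linear_subspace a Phil).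
Qed.

(** Otherwise some points [x n] represent [Phi] on the dual unit ball up to errors tending to 0.
    They form a Cauchy sequence, and by completeness their limit represents [Phi]. *)
Lemma bidual_far :
  exists2 d : R, 0 < d & forall x, exists f,
    [/\ in_dual f, dual_norm_le f 1 & d < Phi f - f x].
Proof.
apply: contrapT => nfar; apply: Phi_notin.
have close (d : R) : 0 < d -> exists x, forall f, in_dual f -> dual_norm_le f 1 ->
    `|Phi f - f x| <= d.
  move=> d0; apply: contrapT => nx; apply: nfar; exists d => // x.
  apply: contrapT => nf; apply: nx; exists x => f fd f1.
  (* The one-sided bound, applied to [f] and to its negative, bounds the absolute value. *)
  have le g : in_dual g -> dual_norm_le g 1 -> Phi g - g x <= d.
    by move=> gd g1; rewrite leNgt; apply/negP => h; apply: nf; exists g.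
  have Nfd : in_dual (fun y => -1 * f y).
    exact: (@subspaceZ _ (X -> R^o) _ dual_linear_subspace (-1) f fd).
  have Nf1 : dual_norm_le (fun y => -1 * f y) 1.
    by have := dual_normZ_le (-1) f1; rewrite normrN1 mul1r.
  have := le _ fd f1; have := le _ Nfd Nf1.
  by rewrite PhiZ// ler_norml /=; lra.
have [eps [eps0 small]] : exists eps : nat -> R, (forall n, 0 < eps n) /\
    forall e : R, 0 < e -> \forall n \near \oo, eps n < e.
  exists (fun n => n.+1%:R^-1); split=> [n|e e0]; first by rewrite invr_gt0.
  exact: (near_infty_natSinv_lt (PosNum e0)).
have [x xP] := choice (fun n => close _ (eps0 n)).
have dist m n : `|x m - x n| <= eps m + eps n.
  have [f [fd f1 <-]] := norming_functional (x m - x n).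
  rewrite (linear_formB _ _ fd.1).
  by have := xP m f fd f1; have := xP n f fd f1; rewrite !ler_norml; lra.
have xcvg : cvg (x @ \oo).
  apply: cauchy_cvg; apply: cauchy_exP => e e0.
  have e20 : 0 < e / 2 by rewrite divr_gt0.
  have [N _ NP] := small _ e20.
  exists (x N), N => // n /= Nn; rewrite -ball_normE /=.
  by have := dist N n; have := NP N (leqnn N); have := NP n Nn; rewrite /=; lra.
exists (lim (x @ \oo)); set y := lim _ in xcvg *.
have unit f : in_dual f -> dual_norm_le f 1 -> Phi f = f y.
  move=> fd f1; apply/eqP; rewrite -subr_eq0 -normr_le0; apply/ler_addgt0Pr => e e0.
  rewrite add0r; have e20 : 0 < e / 2 by rewrite divr_gt0.
  have := small _ e20; have /cvgrPdist_lt/(_ _ e20) := xcvg.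
  move=> yx sm; have [n [/= yxn smn]] := filter_ex (filterI yx sm).
  have := f1.2 (x n - y); rewrite (linear_formB _ _ fd.1) mul1r distrC.
  by have := xP n f fd f1; rewrite !ler_norml; move: yxn smn; rewrite distrC; lra.
(* A general functional is rescaled into the unit ball; dividing by [c + 1] also covers [c = 0]. *)
move=> f fd; have [c0 fc] := dual_normP fd; set c := dual_norm f in c0 fc.
have c1 : 0 < c + 1 by rewrite ltr_wpDl.
have gd : in_dual (fun y => (c + 1)^-1 * f y).
  exact: (@subspaceZ _ (X -> R^o) _ dual_linear_subspace _ f fd).
have g1 : dual_norm_le (fun y => (c + 1)^-1 * f y) 1.
  have [_ g1] := dual_normZ_le (c + 1)^-1 (dual_normP fd).
  split=> // z; apply: le_trans (g1 z) _; rewrite ler_wpM2r//.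
  by rewrite gtr0_norm ?invr_gt0// ler_pdivrMl// mulr1 lerDl.
have c1V : (c + 1)^-1 != 0 by rewrite invr_eq0 gt_eqF.
by apply: (mulfI c1V); rewrite -PhiZ// unit.
Qed.

(** If [Phi f <= d * dual_norm f] for all [f] vanishing at the given points, then [Phi] minus
    evaluation at some [y] obeys this bound on the whole dual, against the choice of [d]. A
    functional violating the bound is rescaled to [Phi f = d], which brings its norm below 1. *)
Lemma james_functional (d : R) (x : nat -> X) n : 0 < d ->
  (forall x, exists f, [/\ in_dual f, dual_norm_le f 1 & d < Phi f - f x]) ->
  exists f, [/\ in_dual f, dual_norm_le f 1, Phi f = d &
    forall i, (i < n)%N -> f (x i) = 0].
Proof.
move=> d0 far.
have [f [fd fx fPhi]] : exists f, [/\ in_dual f,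
    forall i, (i < n)%N -> f (x i) = 0 & d * dual_norm f < Phi f].
  apply: contrapT => nf.
  pose G (g : (X -> R^o) -> R) := exists y, forall f, in_dual f -> g f = f y.
  have [||||||||g [y gy] Phig] := @dominated_on_kernels R (X -> R^o) G in_dual
    (fun f => d * dual_norm f) Phi (fun i f => f (x i)) n.
  - by exists 0 => f fd; rewrite (linear_form0 fd.1).
  - move=> a g h [y gy] [z hz]; exists (a *: y + z) => f fd.
    by rewrite gy// hz// fd.1.
  - move=> g [y gy] a f h fd hd; rewrite !gy//; exact: in_dualL.
  - by move=> i _; exists (x i).
  - exact: dual_linear_subspace.
  - exact: dual_norm_sublinear (ltW d0).
  - exact: bidual_linear_on.
  - move=> f fd fx; rewrite leNgt; apply/negP => h; apply: nf; exists f; split => //.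
  have [f [fd f1 df]] := far y.
  have := Phig f fd; rewrite gy// => /(lt_le_trans df).
  have := dual_norm_min f1; rewrite -(ler_pM2l d0) mulr1; lra.
have [f0 _] := dual_normP fd.
have Pf0 : 0 < Phi f by apply: le_lt_trans fPhi; rewrite mulr_ge0// ltW.
exists (fun y => d / Phi f * f y); split.
- exact: (@subspaceZ _ (X -> R^o) _ dual_linear_subspace _ f fd).
- have [_ g1] := dual_normZ_le (d / Phi f) (dual_normP fd).
  split=> // z; apply: le_trans (g1 z) _; rewrite ler_wpM2r//.
  by rewrite gtr0_norm ?divr_gt0// mulrAC ler_pdivrMr// mul1r ltW.
- by rewrite PhiZ// divfK// gt_eqF.
- by move=> i i_n; rewrite fx// mulr0.
Qed.

(** A form of Helly's theorem. All prescribed values equal [d], so it suffices to find [v] on which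
    the [phi i] agree and [phi n v] exceeds [c] times the norm of [v], and to rescale. If there were
    none, subtracting from [phi n] some [g] with [Phi g = 0] would leave norm at most [c], too small
    for the value [d] of [Phi]. *)
Lemma james_point (d M : R) (phi : nat -> X -> R) n : 0 < d ->
  (forall f c, in_dual f -> dual_norm_le f c -> `|Phi f| <= M * c) ->
  (forall i, (i <= n)%N -> in_dual (phi i) /\ Phi (phi i) = d) ->
  exists x, `|x| <= `|M| + 1 /\ forall i, (i <= n)%N -> phi i x = d.
Proof.
move=> d0 PhiM phiP.
have M10 : 0 < `|M| + 1 by rewrite ltr_wpDl.
(* With this [c], [|M| * c < d] gives the contradiction, while [d / c] is the announced bound on the
   norm of the point. *)
pose c := d / (`|M| + 1).
have c0 : 0 < c by rewrite divr_gt0.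
have [nd nPhi] := phiP n (leqnn n).
have Phil := bidual_linear_on PhiB.
have [v [vn cv]] : exists v, (forall i, (i < n)%N -> phi i v = phi n v) /\
    c * `|v| < phi n v.
  apply: contrapT => nv.
  pose G (g : X -> R) := in_dual g /\ Phi g = 0.
  have [||||||||g [gd Phig] phig] := @dominated_on_kernels R X G setT
    (fun v => c * `|v|) (phi n) (fun i v => -1 * phi n v + phi i v) n.
  - split; first exact: in_dual0.
    exact: (linear_on0 (V := X -> R^o) dual_linear_subspace).
  - move=> a g h [gd g0] [hd h0]; split; first exact: in_dualL.
    by rewrite (Phil a g h)// g0 h0 mulr0 addr0.
  - by move=> g [gd _]; exact: in_dual_linear_on.
  - move=> i i_n; have [id iPhi] := phiP i (ltnW i_n); split; first exact: in_dualL.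
    by rewrite (Phil (-1) (phi n) (phi i))// nPhi iPhi; lra.
  - by split.
  - split=> [v w _ _|t v t0 _]; first by rewrite -mulrDr ler_pM2l// ler_normD.
    by rewrite normrZ gtr0_norm// mulrCA.
  - exact: in_dual_linear_on.
  - move=> v _ vn; rewrite leNgt; apply/negP => h; apply: nv; exists v; split => //.
    by move=> i /vn; lra.
  have hd : in_dual (fun v => -1 * g v + phi n v) by exact: in_dualL.
  have hle v : -1 * g v + phi n v <= c * `|v| by have := phig v Logic.I; lra.
  have hc : dual_norm_le (fun v => -1 * g v + phi n v) c.
    split; first exact: ltW.
    move=> v; rewrite ler_norml hle andbT lerNl -(linear_formN _ hd.1).
    by rewrite -[in leRHS]normrN.
  have := PhiM _ c hd hc; rewrite (Phil (-1) g (phi n))// Phig nPhi mulr0 add0r.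
  rewrite gtr0_norm// leNgt => /negP; apply.
  apply: (@le_lt_trans _ _ (`|M| * c)); first by rewrite ler_wpM2r ?ler_norm// ltW.
  by rewrite /c mulrCA gtr_pMr// ltr_pdivrMr// mul1r ltrDl.
have pv0 : 0 < phi n v by apply: le_lt_trans cv; rewrite mulr_ge0// ltW.
exists ((d / phi n v) *: v); split.
  rewrite normrZ gtr0_norm ?divr_gt0// mulrAC ler_pdivrMr//.
  by move: cv; rewrite /c mulrAC ltr_pdivrMr// mulrC [_ * (_ + 1)]mulrC => /ltW.
have vn' i : (i <= n)%N -> phi i v = phi n v.
  by rewrite leq_eqVlt => /predU1P[->//|]; exact: vn.
move=> i i_n; have [id _] := phiP i i_n.
by rewrite (linear_formZ _ _ id.1) vn'// divfK// gt_eqF.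
Qed.

(** Pairs are chosen recursively: first a functional vanishing at all earlier points, then a point
    where it and all earlier functionals take the value [d]. *)
Lemma james_sequences :
  exists (d r : R) (phi : nat -> X -> R) (x : nat -> X), [/\ 0 < d,
    forall n, in_dual (phi n) /\ dual_norm_le (phi n) 1,
    forall n, `|x n| <= r,
    forall i n, (i <= n)%N -> phi i (x n) = d &
    forall i n, (n < i)%N -> phi i (x n) = 0].
Proof.
have [d d0 far] := bidual_far; have [_ [M PhiM]] := PhiB.
pose S := ((X -> R) * X)%type.
pose o : S := (fun=> 0, 0).
pose valid (s : seq S) := forall i, (i < size s)%N ->
  in_dual (nth o s i).1 /\ Phi (nth o s i).1 = d.
have /choice[next nextP] (s : seq S) : exists p : S, valid s ->
    [/\ in_dual p.1, dual_norm_le p.1 1 & Phi p.1 = d] /\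
    [/\ `|p.2| <= `|M| + 1, p.1 p.2 = d & forall i, (i < size s)%N ->
       (nth o s i).1 p.2 = d /\ p.1 (nth o s i).2 = 0].
  have [sv|] := pselect (valid s); last by exists o.
  have [f [fd f1 Phif fx]] :=
    @james_functional d (fun i => (nth o s i).2) (size s) d0 far.
  (* The default value [f] of [nth] puts the new functional at index [size s], just after the
     earlier ones. *)
  have [|x [xM xd]] := @james_point d M (fun i => nth f (map fst s) i) (size s) d0 PhiM.
    move=> i; rewrite leq_eqVlt => /predU1P[->|i_s].
      by rewrite nth_default ?size_map.
    by rewrite (nth_map o)//; exact: sv.
  exists (f, x) => _; split; split => //=.
    by have := xd _ (leqnn _); rewrite nth_default ?size_map.
  move=> i i_s; split; last exact: fx.
  by have := xd _ (ltnW i_s); rewrite (nth_map o).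
pose s := fix s n := if n is k.+1 then rcons (s k) (next (s k)) else [::].
pose u n := next (s n).
have size_s n : size (s n) = n by elim: n => //= n IH; rewrite size_rcons IH.
have nth_s n i : (i < n)%N -> nth o (s n) i = u i.
  elim: n => //= n IH; rewrite ltnS leq_eqVlt nth_rcons size_s.
  by move=> /predU1P[->|i_n]; [rewrite ltnn eqxx|rewrite i_n IH].
(* Entry [i] of [s n] is [next (s i)] with [i < n], hence the strong induction. *)
have sv n : valid (s n).
  elim/ltn_ind: n => n IH i; rewrite size_s => i_n; rewrite nth_s//.
  by have [[]] := nextP _ (IH i i_n).
have uP n := nextP _ (sv n).
exists d, (`|M| + 1), (fun n => (u n).1), (fun n => (u n).2); split => //.
- by move=> n; have [[]] := uP n.
- by move=> n; have [_ []] := uP n.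
- move=> i n; rewrite leq_eqVlt => /predU1P[->|i_n]; first by have [_ []] := uP n.
  have [_ [_ _ /(_ i)]] := uP n; rewrite size_s => /(_ i_n)[+ _].
  by rewrite nth_s.
- move=> i n n_i; have [_ [_ _ /(_ n)]] := uP i; rewrite size_s => /(_ n_i)[_ +].
  by rewrite nth_s.
Qed.

End James.

(** * Condition (c) and functions with a non-d.c. reciprocal *)

Lemma closed_approx {R : realType} {X : normedModType R} (A : set X) :
  (forall p, (forall e : R, 0 < e -> exists2 q, A q & `|p - q| < e) -> A p) ->
  closed A.
Proof.
move=> AP p Ap; apply: AP => e e0.
have [q [Aq pq]] := Ap _ (nbhsx_ballx p e e0).
by exists q => //; move: pq; rewrite -ball_normE.
Qed.

Section DecreasingSets.
Context {R : realType} {X : normedModType R}.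

Definition nested_convex_sets (C : nat -> set X) :=
  (forall n, bounded_subset (C n) /\ closed (C n) /\
             convex_set (R := R) (M := X) (C n)) /\
  (forall n, C n.+1 `<=` C n) /\
  \bigcap_n C n = set0 /\
  (forall eps : R, 0 < eps -> \bigcap_n enlarge (C n) eps !=set0).

Variables (d r : R) (phi : nat -> X -> R) (x : nat -> X).
Hypothesis d0 : 0 < d.
Hypothesis phiP : forall n, in_dual (phi n) /\ dual_norm_le (phi n) 1.
Hypothesis xr : forall n, `|x n| <= r.
Hypothesis phix : forall i n, (i <= n)%N -> phi i (x n) = d.
Hypothesis phix0 : forall i n, (n < i)%N -> phi i (x n) = 0.

(** Convergence of [phi j y] to 0. It holds at every [x k], survives norm limits since the [phi j]
    are 1-Lipschitz, and forces the intersection of the sets below to be empty. *)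
Definition null_along y :=
  forall e : R, 0 < e -> exists N, forall j, (N <= j)%N -> `|phi j y| < e.

(* [james_set n] contains [x k + (k + 1)^-1 x m] for all [k] and all
   [m >= n], so [x k] is [r / (k + 1)]-close to every [james_set n]. *)
Definition james_set n : set X := [set y | [/\ `|y| <= 2 * r, null_along y &
  forall j N, (j <= N)%N -> (N <= n)%N -> d <= phi j y + j.+1%:R * phi N y]].

Let phil j (a : R) y z : phi j (a *: y + z) = a * phi j y + phi j z.
Proof. exact: (phiP j).1.1. Qed.

Let phiB j y z : `|phi j y - phi j z| <= `|y - z|.
Proof.
have [pd [_ /(_ (y - z))]] := phiP j.
by rewrite mul1r (linear_formB _ _ pd.1).
Qed.

Lemma james_set_closed n : closed (james_set n).
Proof.
apply: closed_approx => p pP; split.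
- apply/ler_addgt0Pr => e e0; have [q [qr _ _] pq] := pP e e0.
  have := ler_normD q (p - q); rewrite subrKC => /le_trans; apply.
  by rewrite lerD// ltW.
- move=> e e0; have e20 : 0 < e / 2 by rewrite divr_gt0.
  have [q [_ /(_ _ e20)[N NP] _] pq] := pP _ e20.
  exists N => j Nj; have := NP j Nj; have := phiB j p q.
  by rewrite ler_norml !ltr_norml; lra.
- move=> j N jN Nn; apply/ler_addgt0Pr => e e0.
  have j0 : 0 < j.+1%:R + 1 :> R by rewrite ltr_wpDl.
  (* The map [phi j + (j + 1) phi N] has Lipschitz constant at most [(j + 1) + 1], which dictates
     the tolerance. *)
  have [q [_ _ qP] pq] := pP (e / (j.+1%:R + 1)) (divr_gt0 e0 j0).
  apply: le_trans (qP j N jN Nn) _; rewrite -lerBlDl.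
  apply: (@le_trans _ _ ((j.+1%:R + 1) * `|p - q|)); last first.
    by rewrite mulrC -ler_pdivlMr// ltW.
  have h1 : phi j q - phi j p <= `|p - q|.
    by rewrite distrC (le_trans (ler_norm _))// phiB.
  have h2 : phi N q - phi N p <= `|p - q|.
    by rewrite distrC (le_trans (ler_norm _))// phiB.
  have := ler_wpM2l (ler0n R j.+1) h2.
  rewrite mulrBr mulrDl mul1r => h3.
  by apply: le_trans (lerD h3 h1); rewrite le_eqVlt; apply/orP; left; apply/eqP; ring.
Qed.

Lemma james_set_convex n : convex_set (R := R) (M := X) (james_set n).
Proof.
apply/convex_setP => t y z /andP[t0 t1] [yr y0 yP] [zr z0 zP].
have s0 : 0 <= 1 - t by rewrite subr_ge0.
have phiE j : phi j (t *: y + (1 - t) *: z) = t * phi j y + (1 - t) * phi j z.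
  by rewrite phil (linear_formZ _ _ (phiP j).1.1).
split.
- apply: le_trans (ler_normD _ _) _; rewrite !normrZ !ger0_norm//.
  apply: le_trans (lerD (ler_wpM2l t0 yr) (ler_wpM2l s0 zr)) _.
  by rewrite -mulrDl subrKC mul1r.
- move=> e e0; have e20 : 0 < e / 2 by rewrite divr_gt0.
  have [N NP] := y0 _ e20; have [N' NP'] := z0 _ e20.
  exists (maxn N N') => j; rewrite geq_max => /andP[/NP jy /NP' jz].
  rewrite phiE; apply: le_lt_trans (ler_normD _ _) _.
  rewrite !normrM (ger0_norm t0) (ger0_norm s0).
  apply: le_lt_trans (lerD (ler_wpM2l t0 (ltW jy)) (ler_wpM2l s0 (ltW jz))) _.
  by rewrite -mulrDl subrKC mul1r; lra.
- move=> j N jN Nn; rewrite !phiE.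
  have := ler_wpM2l t0 (yP _ _ jN Nn); have := ler_wpM2l s0 (zP _ _ jN Nn).
  move=> h1 h2; have := lerD h2 h1; rewrite -mulrDl subrKC mul1r => /le_trans; apply.
  by rewrite le_eqVlt; apply/orP; left; apply/eqP; ring.
Qed.

(** If [j <= k], the term [phi j (x k) = d] suffices. If [j > k], both functionals vanish at [x k],
    and the factor [j + 1] compensates the coefficient [1 / (k + 1)] of [x m]. *)
Lemma james_set_mem n k m : (n <= m)%N -> james_set n (x k + k.+1%:R^-1 *: x m).
Proof.
move=> nm; set c := k.+1%:R^-1.
have c0 : 0 < c by rewrite invr_gt0.
have c1 : c <= 1 by rewrite invf_le1// ler1n.
have phiE j : phi j (x k + c *: x m) = phi j (x k) + c * phi j (x m).
  by rewrite addrC phil addrC.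
split.
- apply: le_trans (ler_normD _ _) _; rewrite normrZ gtr0_norm//.
  have := ler_pM (ltW c0) (normr_ge0 (x m)) c1 (xr m); have := xr k; lra.
- move=> e e0; exists (maxn k m).+1 => j; rewrite gtn_max => /andP[kj mj].
  by rewrite phiE !phix0// mulr0 addr0 normr0.
- move=> j N jN Nn; rewrite !phiE.
  have jm : (j <= m)%N by rewrite (leq_trans jN)// (leq_trans Nn).
  rewrite (phix jm) (phix (leq_trans Nn nm)).
  have cd0 : 0 < c * d by rewrite mulr_gt0.
  have [jk|kj] := leqP j k.
    rewrite (phix jk).
    have : 0 <= phi N (x k).
      by have [Nk|kN] := leqP N k; rewrite ?(phix Nk) ?(phix0 kN)// ltW.
    move=> h; rewrite -addrA lerDl addr_ge0//; first exact: ltW.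
    by rewrite mulr_ge0// addr_ge0// ltW.
  rewrite (phix0 kj) (phix0 (leq_trans kj jN)) !add0r.
  have : d <= j.+1%:R * (c * d).
    rewrite mulrA ler_peMl ?(ltW d0)//.
    by rewrite ler_pdivlMr// mul1r ler_nat ltnW.
  by move=> /le_trans; apply; rewrite lerDr ltW.
Qed.

Lemma james_set_nested : nested_convex_sets james_set.
Proof.
split; [|split; [|split]].
- move=> n; split; first by exists (2 * r) => y [].
  by split; [exact: james_set_closed|exact: james_set_convex].
- by move=> n y [yr y0 yP]; split => // j N jN Nn; apply: yP => //; exact: leqW.
- apply/seteqP; split => // y yC.
  have d20 : 0 < d / 2 by rewrite divr_gt0.
  have [_ y0 _] := yC 0%N Logic.I.
  (* First [j] makes [phi j y] less than [d / 2], then a large index [N] makes [(j + 1) phi N y]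
     less than [d / 2], against the defining inequality. *)
  have [j /(_ j (leqnn j)) jP] := y0 _ d20.
  have [N NP] := y0 _ (divr_gt0 d20 (ltr0Sn R j)).
  have [_ _ /(_ j (maxn j N) (leq_maxl _ _) (leqnn _))] := yC (maxn j N) Logic.I.
  have := NP _ (leq_maxr j N); rewrite ltr_pdivlMr// mulrC => NP'.
  have := le_lt_trans (ler_wpM2l (ler0n R j.+1) (ler_norm (phi (maxn j N) y))) NP'.
  by have := le_lt_trans (ler_norm _) jP; lra.
- move=> e e0; have r0 : 0 <= r by exact: le_trans (normr_ge0 _) (xr 0%N).
  have [k kr] : exists k : nat, r / e < k.+1%:R.
    by exists (Num.trunc (r / e)); exact: truncnS_gt.
  exists (x k) => n _; exists (x k + k.+1%:R^-1 *: x n); first exact: james_set_mem.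
  rewrite opprD addrA subrr sub0r normrN normrZ gtr0_norm ?invr_gt0//.
  rewrite ler_pdivrMl//; apply: le_trans (xr n) _.
  by rewrite -ler_pdivrMr// ltW.
Qed.

End DecreasingSets.

(** * A convex function with a non-d.c. reciprocal *)

Section UnboundedReciprocal.
Context {R : realType} {X : normedModType R}.
Variables (C : nat -> set X) (M : R).
Hypothesis C0 : forall n, C n !=set0.
Hypothesis CM : forall n c, C n c -> `|c| <= M.
Hypothesis Ccl : forall n, closed (C n).
Hypothesis Cconv : forall n, convex_set (R := R) (M := X) (C n).
Hypothesis Cmono : forall m n, (m <= n)%N -> C n `<=` C m.

Let terms y : set R := [set n.+1%:R^-1 * distance (C n) y | n in setT].

Definition weighted_distance y : R := sup (terms y).

Let w0 n : 0 < n.+1%:R^-1 :> R. Proof. by rewrite invr_gt0. Qed.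
Let w1 n : n.+1%:R^-1 <= 1 :> R. Proof. by rewrite invf_le1// ler1n. Qed.

Lemma distance_bound n y : distance (C n) y <= `|y| + M.
Proof.
have [c Cc] := C0 n; apply: le_trans (distance_le y Cc) _.
by apply: le_trans (ler_normB _ _) _; rewrite lerD2l (CM Cc).
Qed.

Let terms_ub y : has_ubound (terms y).
Proof.
exists (`|y| + M) => _ [n _ <-]; apply: le_trans (distance_bound n y).
by rewrite ler_piMl// distance_ge0.
Qed.

Lemma weighted_distance_ge n y : n.+1%:R^-1 * distance (C n) y <= weighted_distance y.
Proof. by apply: ub_le_sup => //; exists n. Qed.

Lemma weighted_distance_le y (b : R) :
  (forall n, n.+1%:R^-1 * distance (C n) y <= b) -> weighted_distance y <= b.
Proof.
move=> h; apply: ge_sup; first by exists (1%:R^-1 * distance (C 0%N) y), 0%N.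
by move=> _ [n _ <-].
Qed.

(** A supremum of convex functions that are 1-Lipschitz, as the weights are at most 1. *)
Lemma weighted_distance_cont_convex : cont_convex weighted_distance.
Proof.
split.
  have le u v : weighted_distance u <= weighted_distance v + `|u - v|.
    apply: weighted_distance_le => n.
    apply: (@le_trans _ _ (n.+1%:R^-1 * distance (C n) v + `|u - v|)); last first.
      by rewrite lerD2r weighted_distance_ge.
    have := distance_lipschitz u v (C0 n); rewrite ler_norml => /andP[_ h].
    rewrite -lerBlDl -mulrBr; apply: le_trans (ler_wpM2l (ltW (w0 n)) h) _.
    by rewrite ler_piMl.
  apply: (@lipschitz_continuous _ _ _ 1) => u v; rewrite mul1r ler_norml.
  by have := le u v; have := le v u; rewrite (distrC v); lra.
apply/convex_functionP => t y z t01; have /andP[t0 t1] := t01.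
apply: weighted_distance_le => n.
have h := distance_convex y z (C0 n) (@Cconv n) t01.
apply: le_trans (ler_wpM2l (ltW (w0 n)) h) _.
rewrite mulrDr (mulrCA _ t) (mulrCA _ (1 - t)).
by rewrite lerD// ler_wpM2l ?subr_ge0//; exact: weighted_distance_ge.
Qed.

Lemma weighted_distance_gt0 y : \bigcap_n C n = set0 -> 0 < weighted_distance y.
Proof.
move=> Ce; have [n nCy] : exists n, ~ C n y.
  apply/existsNP => yC; have : (\bigcap_n C n) y by move=> n _; exact: yC.
  by rewrite Ce.
apply: lt_le_trans (weighted_distance_ge n y).
by rewrite mulr_gt0//; exact: distance_gt0.
Qed.

(** The terms of index at most [n] vanish at [c]; the others have weight at most [1 / (n + 1)] and
    distance at most [2 * M]. *)
Lemma weighted_distance_small n c : C n c ->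
  weighted_distance c <= n.+1%:R^-1 * (2 * M).
Proof.
move=> Cc; have cM := CM Cc; have M0 : 0 <= M by exact: le_trans (normr_ge0 _) cM.
apply: weighted_distance_le => m; have [mn|nm] := leqP m n.
  by rewrite (distance_mem (Cmono mn Cc)) mulr0 mulr_ge0 ?mulr_ge0// ltW.
apply: ler_pM; rewrite ?(ltW (w0 _)) ?distance_ge0//.
  by rewrite lef_pV2 ?posrE// ler_nat ltnW.
by have := distance_bound m c; lra.
Qed.

(* If [1 / weighted_distance] were d.c. it would lie below a continuous convex
   function, bounded near [0]; by convexity that function is then bounded on a
   ball meeting every [C n], where [1 / weighted_distance] is unbounded. *)
Lemma weighted_distance_not_dc :
  (forall eps : R, 0 < eps -> \bigcap_n enlarge (C n) eps !=set0) ->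
  (forall y, 0 < weighted_distance y) ->
  ~ is_dc (fun y => (weighted_distance y)^-1).
Proof.
move=> Cnear fpos [g1 [g2 [[g1c /convex_functionP g1v] [[g2c /convex_functionP g2v] fE]]]].
have half01 : 0 <= (2^-1 : R) <= 1 by lra.
have halfE : 1 - 2^-1 = 2^-1 :> R by lra.
have g1h u v : g1 (2^-1 *: u + 2^-1 *: v) <= 2^-1 * g1 u + 2^-1 * g1 v.
  by have := g1v _ u v half01; rewrite halfE.
have g2h u v : g2 (2^-1 *: u + 2^-1 *: v) <= 2^-1 * g2 u + 2^-1 * g2 v.
  by have := g2v _ u v half01; rewrite halfE.
(* Midpoint convexity of [g2] at 0 bounds [- g2 y] by [g2 (- y) - 2 * g2 0], so [G] is a convex
   majorant up to a constant. *)
pose G y := g1 y + g2 (- y).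
have fG y : (weighted_distance y)^-1 <= G y - 2 * g2 0.
  by have := g2h y (- y); rewrite -scalerDr subrr scaler0 fE /G; lra.
have Gh u v : G (2^-1 *: u + 2^-1 *: v) <= 2^-1 * G u + 2^-1 * G v.
  by have := g1h u v; have := g2h (- u) (- v); rewrite /G !scalerN -opprD; lra.
have Gcont : {for 0, continuous G}.
  apply: cvgD; first exact: g1c.
  by apply: continuous_comp; [exact: opp_continuous|exact: g2c].
have /cvgrPdist_lt/(_ 1 ltr01)/nbhs_ballP[e /= e0 eP] := Gcont.
have Gle v : `|v| < e -> G v <= G 0 + 1.
  move=> ve; have := eP v; rewrite -ball_normE /= sub0r normrN => /(_ ve).
  by rewrite ltr_norml; lra.
have [y yP] := Cnear (e / 4) (divr_gt0 e0 (ltr0n _ 4)).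
(* A point [c] of [C n] within [e / 4] of [y] is the midpoint of [2 y] and [2 (c - y)], the latter
   lying in the ball where [G] is bounded. *)
pose B := 2^-1 * G (2 *: y) + 2^-1 * (G 0 + 1) - 2 * g2 0.
have cB n : exists2 c, C n c & (weighted_distance c)^-1 <= B.
  have [c Cc yc] := yP n Logic.I; exists c => //.
  apply: le_trans (fG c) _; rewrite lerD2r.
  have := Gh (2 *: y) (2 *: (c - y)).
  rewrite !scalerA mulVf// !scale1r addrC subrK => /le_trans; apply.
  rewrite lerD2l ler_wpM2l// Gle// normrZ ger0_norm// distrC.
  by have := yc; lra.
have B0 : 0 < B.
  by have [c _] := cB 0%N; apply: lt_le_trans; rewrite invr_gt0.
(* Then [n + 1 > 2 * M * B], whereas the bounds at a point of [C n] give [n + 1 <= 2 * M * B]. *)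
pose n := Num.trunc (2 * M * B).
have [c Cc] := cB n.
rewrite -[leRHS]invrK lef_pV2 ?posrE ?invr_gt0// => Bf.
have := le_trans Bf (weighted_distance_small Cc).
rewrite -[_^-1]mulr1 ler_pdivrMl// mulrCA ler_pdivlMl// mulr1 mulrC.
by rewrite leNgt truncnS_gt.
Qed.

End UnboundedReciprocal.

(** * Reciprocals in reflexive spaces *)

(** Supplies a common truncation index, so that a hinge series at three points is given by one
    finite sum. *)
Lemma nat_ub3 {R : realType} (k : nat) (a b c : R) :
  exists N, [/\ (k < N)%N, a <= N%:R, b <= N%:R & c <= N%:R].
Proof.
pose N := (maxn k (maxn (Num.trunc a) (maxn (Num.trunc b) (Num.trunc c)))).+1.
have le v : (Num.trunc v < N)%N -> v <= N%:R :> R.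
  by move=> vN; rewrite ltW// (lt_le_trans (truncnS_gt v))// ler_nat.
exists N; split; first by rewrite ltnS leq_max leqnn.
all: by apply: le; rewrite ltnS !leq_max leqnn ?orbT.
Qed.

(** * Convex functions on the line with prescribed growth of slopes *)

Section Hinge.
Context {R : realType}.
Variable c : nat -> R.
Hypothesis c0 : forall i, 0 <= c i.
Implicit Types s t : R.

Definition hinge_sum N s := \sum_(i < N) c i * Num.max 0 (s - i%:R).

(** The infinite sum of [c i * max 0 (s - i)]: it is locally finite, since all terms with [i >= s]
    vanish. *)
Definition hinge_series s := hinge_sum (Num.trunc s).+1 s.

Let hinge_mono s t (a : R) : s <= t -> Num.max 0 (s - a) <= Num.max 0 (t - a).
Proof. by move=> st; rewrite !maxEle; do 2 case: ifPn; rewrite -?ltNge; lra. Qed.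

Lemma hinge_sum_stable N N' s : s <= N%:R -> (N <= N')%N ->
  hinge_sum N' s = hinge_sum N s.
Proof.
move=> sN /subnK <-; elim: (N' - N)%N => // k IH.
rewrite addSn /hinge_sum big_ord_recr /= -/(hinge_sum _ _) IH.
rewrite max_l ?mulr0 ?addr0// subr_le0 (le_trans sN)// ler_nat leq_addl//.
Qed.

Lemma hinge_seriesE N s : s <= N%:R -> hinge_series s = hinge_sum N s.
Proof.
move=> sN; have sT : s <= (Num.trunc s).+1%:R by rewrite ltW// truncnS_gt.
have [NT|/ltnW TN] := leqP N (Num.trunc s).+1; first exact: hinge_sum_stable.
by rewrite (hinge_sum_stable sT TN).
Qed.

Lemma le_hinge_sum N s t : s <= t -> hinge_sum N s <= hinge_sum N t.
Proof. by move=> st; apply: ler_sum => i _; rewrite ler_wpM2l// hinge_mono. Qed.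

Lemma hinge_sum_convex N s t (a : R) : 0 <= a <= 1 ->
  hinge_sum N (a * s + (1 - a) * t) <= a * hinge_sum N s + (1 - a) * hinge_sum N t.
Proof.
move=> /andP[a0 a1]; rewrite !mulr_sumr -big_split /=; apply: ler_sum => i _.
rewrite !(mulrCA _ (c i)) -mulrDr ler_wpM2l//.
have b0 : 0 <= 1 - a by lra.
have le_max (u : R) : u <= Num.max 0 u /\ 0 <= Num.max 0 u.
  by rewrite !le_max !lexx orbT.
have [h1 h2] := le_max (s - i%:R); have [h3 h4] := le_max (t - i%:R).
rewrite ge_max addr_ge0 ?mulr_ge0//=.
apply: le_trans (lerD (ler_wpM2l a0 h1) (ler_wpM2l b0 h3)).
by rewrite le_eqVlt; apply/orP; left; apply/eqP; ring.
Qed.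

(** The [k]-th hinge alone contributes [c k * (t - s)], and the other terms are nondecreasing. *)
Lemma hinge_sum_slope N k s t : (k < N)%N -> k%:R <= s -> s <= t ->
  c k * (t - s) <= hinge_sum N t - hinge_sum N s.
Proof.
move=> kN ks st; rewrite /hinge_sum -sumrB (bigD1 (Ordinal kN))//=.
rewrite -[leLHS]addr0; apply: lerD; last first.
  by apply: sumr_ge0 => i _; rewrite -mulrBr mulr_ge0// subr_ge0 hinge_mono.
rewrite -mulrBr !max_r ?subr_ge0 ?(le_trans ks)//.
by rewrite le_eqVlt; apply/orP; left; apply/eqP; ring.
Qed.

Lemma hinge_sum_continuous N : continuous (hinge_sum N : R^o -> R).
Proof.
apply: (@lipschitz_continuous _ R^o _ (\sum_(i < N) c i)) => s t.
rewrite /hinge_sum -sumrB mulr_suml; apply: le_trans (ler_norm_sum _ _ _) _.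
apply: ler_sum => i _; rewrite -mulrBr normrM ger0_norm// ler_wpM2l//.
have := ler_norm (s - t); have := lerNnormlW (lexx `|s - t|).
by rewrite ler_norml !maxEle; do 2 case: ifPn; rewrite -?ltNge; lra.
Qed.

End Hinge.

Lemma inv_convex {R : realType} (a b t : R) : 0 < a -> 0 < b -> 0 <= t <= 1 ->
  (t * a + (1 - t) * b)^-1 <= t * a^-1 + (1 - t) * b^-1.
Proof.
move=> a0 b0 /andP[t0 t1]; set u := t * a + (1 - t) * b.
have s0 : 0 <= 1 - t by lra.
have u0 : 0 < u.
  have [t1'|t1'] := ltP t 1.
    by rewrite ltr_wpDl ?mulr_ge0 ?(ltW a0)// mulr_gt0// subr_gt0.
  by rewrite ltr_pwDl ?mulr_ge0 ?(ltW b0)// mulr_gt0// (lt_le_trans ltr01).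
(* the tangent line of the inverse at [u] *)
have tangent x : 0 < x -> 2 * u^-1 - x * u^-1 ^+ 2 <= x^-1.
  move=> x0; rewrite -subr_ge0.
  have -> : x^-1 - (2 * u^-1 - x * u^-1 ^+ 2) = x^-1 * (1 - x * u^-1) ^+ 2.
    by field; rewrite !gt_eqF.
  by rewrite mulr_ge0 ?invr_ge0 ?sqr_ge0// ltW.
apply: le_trans (lerD (ler_wpM2l t0 (tangent a a0)) (ler_wpM2l s0 (tangent b b0))).
have -> : t * (2 * u^-1 - a * u^-1 ^+ 2) + (1 - t) * (2 * u^-1 - b * u^-1 ^+ 2) =
  2 * u^-1 - u * u^-1 ^+ 2 by rewrite /u; ring.
by rewrite expr2 mulrA divff ?gt_eqF// mul1r; lra.
Qed.

Section ReciprocalDC.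
Context {R : realType} {X : normedModType R}.

(* With slopes [c k >= f^-2] on the ball of radius [k + 1], the convex function
   [hinge_series c (f + norm)] outgrows the decrease of [1 / f]. *)
Lemma reciprocal_dc (f : X -> R) : cont_convex f -> (forall x, 0 < f x) ->
  (forall r : R, exists2 m : R, 0 < m & forall x, `|x| <= r -> m <= f x) ->
  is_dc (fun x => (f x)^-1).
Proof.
move=> [fc /convex_functionP fv] f0 fm.
have /choice[m mP] (k : nat) : exists m : R, 0 < m /\
    forall x : X, `|x| <= k.+1%:R -> m <= f x.
  by have [m m0 mf] := fm k.+1%:R; exists m.
(* This bounds the slope of the inverse function on values at least [m k]. *)
pose c k := (m k)^-1 ^+ 2.
have c0 k : 0 <= c k by exact: sqr_ge0.
pose g x := f x + `|x|.
pose K x := hinge_series c (g x).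
have Kc : continuous K.
  move=> x; pose N := (Num.trunc (g x)).+1.
  have gx : g x < N%:R by exact: truncnS_gt.
  have gc : continuous g by move=> y; apply: cvgD; [exact: fc|exact: norm_continuous].
  (* Near [x] the series agrees with one finite sum, which is continuous. *)
  have KN : {near x, (hinge_sum c N \o g) =1 K}.
    near=> y; rewrite /K (@hinge_seriesE _ c N)//.
    by apply: ltW; near: y; apply: (cvgr_lt (g x)) => //; exact: gc.
  have KE : K x = (hinge_sum c N \o g) x by rewrite /K (@hinge_seriesE _ c N)// ltW.
  rewrite /continuous_at KE; apply: cvg_trans.
    by apply: near_eq_cvg; exact: KN.
  apply: continuous_comp; first exact: gc.
  exact: (hinge_sum_continuous c0).
have gv t x y : 0 <= t <= 1 ->
    g (t *: x + (1 - t) *: y) <= t * g x + (1 - t) * g y.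
  move=> t01; have /andP[t0 t1] := t01; have := fv t x y t01.
  have := ler_normD (t *: x) ((1 - t) *: y).
  rewrite !normrZ ger0_norm// ger0_norm ?subr_ge0// /g; lra.
have Kv : forall (t : R) x y, 0 <= t <= 1 ->
    K (t *: x + (1 - t) *: y) <= t * K x + (1 - t) * K y.
  move=> t x y t01; have gxy := gv t x y t01.
  have [N [_ xN yN sN]] := nat_ub3 0%N (g x) (g y) (t * g x + (1 - t) * g y).
  rewrite /K !(@hinge_seriesE _ c N)//; last exact: le_trans gxy sN.
  exact: le_trans (le_hinge_sum c0 N gxy) (hinge_sum_convex c0 _ _ _ t01).
exists (fun x => (f x)^-1 + K x), K; split; last split.
- split.
    move=> x; apply: cvgD; last exact: Kc.
    by apply: cvgV; [rewrite gt_eqF|exact: fc].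
  apply/convex_functionP => t x y t01; have /andP[t0 t1] := t01.
  set z := t *: x + (1 - t) *: y.
  pose u := t * f x + (1 - t) * f y; pose s := t * g x + (1 - t) * g y.
  have fu : f z <= u by exact: fv.
  (* The convexity gap of [g] is at least that of [f], because the norm adds a nonnegative gap. *)
  have gs : u - f z <= s - g z.
    rewrite /u /s /g; have := ler_normD (t *: x) ((1 - t) *: y).
    by rewrite -/z !normrZ (ger0_norm t0) ger0_norm ?subr_ge0//; lra.
  (* This index serves twice: the norm of [z] is below [k + 1], so [f z >= m k], and [k <= g z], so
     the slope [c k] is available from [g z] on. *)
  pose k := Num.trunc `|z|.
  have [N [kN xN yN sN]] := nat_ub3 k (g x) (g y) s.
  have gzs : g z <= s by exact: gv.
  have zN : g z <= N%:R by exact: le_trans sN.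
  rewrite /K !(@hinge_seriesE _ c N)//.
  have kz : k%:R <= g z.
    apply: (@le_trans _ _ `|z|); first by rewrite truncn_le.
    by rewrite lerDr ltW.
  have slope := @hinge_sum_slope _ c c0 N k (g z) s kN kz gzs.
  have conv := @hinge_sum_convex _ c c0 N (g x) (g y) t t01.
  rewrite -/s in conv.
  have iconv := inv_convex (f0 x) (f0 y) t01.
  rewrite -/u in iconv.
  have [m0 /(_ z) mz] := mP k.
  have {}mz : m k <= f z by apply: mz; rewrite ltW// truncnS_gt.
  have drop : (f z)^-1 - u^-1 <= c k * (u - f z).
    have u0 : 0 < u by exact: lt_le_trans fu.
    have -> : (f z)^-1 - u^-1 = ((f z)^-1 * u^-1) * (u - f z).
      by field; rewrite !gt_eqF.
    rewrite ler_wpM2r ?subr_ge0// /c expr2 ler_pM ?invr_ge0 ?(ltW (f0 z)) ?(ltW u0)//.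
      by rewrite lef_pV2 ?posrE.
    by rewrite lef_pV2 ?posrE// (le_trans mz).
  (* The excess of [1 / f z] over [1 / u] is at most [c k * (u - f z)], hence at most the gain of
     the series from [g z] to [s]. *)
  have := ler_wpM2l (c0 k) gs; lra.
- by split => //; apply/convex_functionP.
- by move=> x; rewrite addrK.
Unshelve. all: by end_near. Qed.

(** Otherwise the sublevel sets of [f] at heights [1 / (n + 1)] in the ball of radius [r] are
    nonempty and nested, and a common point would have [f x <= 0]. *)
Lemma reflexive_convex_bounded_below (f : X -> R) (r : R) :
  reflexive_space (X := X) -> cont_convex f -> (forall x, 0 < f x) ->
  exists2 m : R, 0 < m & forall x, `|x| <= r -> m <= f x.
Proof.
move=> Xrefl [fc /convex_functionP fv] f0; apply: contrapT => nm.
pose C n : set X := [set x | `|x| <= r /\ f x <= n.+1%:R^-1].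
have [n||n|n|n x [xr fx]|x xC] := @reflexive_nested _ _ C Xrefl.
- apply: contrapT => nC; apply: nm; exists n.+1%:R^-1; first by rewrite invr_gt0.
  move=> x xr; rewrite leNgt; apply/negP => h; apply: nC.
  by exists x; split => //; exact: ltW.
- by exists r => x [].
- apply: closedI.
    apply: (@closed_comp _ _ (fun x : X => `|x|) [set y | y <= r]).
      by move=> x _; exact: norm_continuous.
    exact: closed_le.
  apply: (@closed_comp _ _ f [set y | y <= n.+1%:R^-1]); last exact: closed_le.
  by move=> x _; exact: fc.
- apply/convex_setP => t x y t01 [xr fx] [yr fy]; have /andP[t0 t1] := t01.
  have s0 : 0 <= 1 - t by rewrite subr_ge0.
  split.
    apply: le_trans (ler_normD _ _) _; rewrite !normrZ !ger0_norm//.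
    apply: le_trans (lerD (ler_wpM2l t0 xr) (ler_wpM2l s0 yr)) _.
    by rewrite -mulrDl subrKC mul1r.
  apply: le_trans (fv _ _ _ t01) _.
  apply: le_trans (lerD (ler_wpM2l t0 fx) (ler_wpM2l s0 fy)) _.
  by rewrite -mulrDl subrKC mul1r.
- by split=> //; apply: le_trans fx _; rewrite lef_pV2 ?posrE// ler_nat.
- have [_ fx] := xC (Num.trunc (f x)^-1); move: fx; apply/negP; rewrite -ltNge.
  by rewrite invf_plt ?posrE// truncnS_gt.
Qed.

End ReciprocalDC.

(** * The implications between the three properties *)

Section Implications.
Context {R : realType}.

Lemma nonreflexive_nested_convex_sets (X : completeNormedModType R) :
  ~ reflexive_space (X := X) ->
  exists C : nat -> set X, nested_convex_sets C.
Proof.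
move=> /existsNP[Phi /not_implyP[PhiB Phi_notin]].
have [d [r [phi [x [d0 phiP xr phix phix0]]]]] := james_sequences PhiB Phi_notin.
by exists (james_set d r phi); exact: (james_set_nested d0 phiP xr phix phix0).
Qed.

Context {X : normedModType R}.

Lemma nested_convex_sets_nonempty (C : nat -> set X) n :
  nested_convex_sets C -> C n !=set0.
Proof.
move=> [_ [_ [_ /(_ 1 ltr01)[y yP]]]].
by have [c Cc _] := yP n Logic.I; exists c.
Qed.

Lemma reflexive_no_nested_convex_sets (C : nat -> set X) :
  nested_convex_sets C -> ~ reflexive_space (X := X).
Proof.
move=> CP Xrefl; have [Cbcc [Cdec [Ce _]]] := CP.
have [n||n|n||x xC] := @reflexive_nested _ _ C Xrefl.
- exact: nested_convex_sets_nonempty.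
- by have [] := Cbcc 0%N.
- by have [_ []] := Cbcc n.
- by have [_ []] := Cbcc n.
- exact: Cdec.
- have : (\bigcap_n C n) x by move=> n _.
  by rewrite Ce.
Qed.

Lemma nested_convex_sets_reciprocal (C : nat -> set X) :
  nested_convex_sets C ->
  exists f : X -> R, cont_convex f /\ (forall x, 0 < f x) /\
     ~ is_dc (fun x => (f x)^-1).
Proof.
move=> CP; have [Cbcc [Cdec [Ce Cnear]]] := CP.
have C0 n := nested_convex_sets_nonempty n CP.
have Ccl n : closed (C n) by have [_ []] := Cbcc n.
have Cconv n : convex_set (R := R) (M := X) (C n) by have [_ []] := Cbcc n.
have Cmono m n : (m <= n)%N -> C n `<=` C m.
  by move=> /subnK <-; elim: (n - m)%N => // k IH y; rewrite addSn => /Cdec; exact: IH.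
have [[M C0M] _] := Cbcc 0%N.
have CM n c : C n c -> `|c| <= M by move=> /(Cmono 0%N n isT)/C0M.
have fpos y : 0 < weighted_distance C y by exact: (weighted_distance_gt0 C0 CM).
exists (weighted_distance C); split; last split=> //.
  exact: (weighted_distance_cont_convex C0 CM).
exact: (weighted_distance_not_dc C0 CM).
Qed.

End Implications.

Theorem theorem4 (R : realType) (X : completeNormedModType R) :
  (~ reflexive_space (X := X) <->
   exists f : X -> R, cont_convex f /\ (forall x, 0 < f x) /\
     ~ is_dc (fun x => (f x)^-1)) /\
  (~ reflexive_space (X := X) <->
   exists C : nat -> set X,
     (forall n, bounded_subset (C n) /\ closed (C n) /\
                convex_set (R := R) (M := X) (C n)) /\
     (forall n, C n.+1 `<=` C n) /\
     \bigcap_n C n = set0 /\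
     (forall eps : R, 0 < eps -> \bigcap_n enlarge (C n) eps !=set0)).
Proof.
split; split.
(* Property (b) is reached from (a) through the sets of (c). *)
- by move=> /nonreflexive_nested_convex_sets[C /nested_convex_sets_reciprocal].
- move=> [f [fcc [f0 fndc]]] Xrefl; apply: fndc; apply: reciprocal_dc => // r.
  exact: reflexive_convex_bounded_below.
- exact: nonreflexive_nested_convex_sets.
- by move=> [C CP]; exact: (reflexive_no_nested_convex_sets CP).
Qed.
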